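(* Let $r\ge1$, let $N\subset A$ be a non-zero proper ideal satisfying the level assumption, and let $R$ be any commutative $F$-algebra. Let $\varphi'\colon A\to R[\tau]$ be a standard Drinfeld $A$-module of rank $1\le s\le r$ with a level $N$-structure $\lambda'\colon V^s_N\to R$, and let $i\colon V^s_N\hookrightarrow V^r_N$ be any injective $A$-linear map. Then the map $$\rho\colon V^r_N\setminus\{0\}\to R,\quad v\mapsto\begin{cases}\lambda'(w)^{-1}&\text{if } v=i(w)\text{ for } w\in V^s_N,\\ 0&\text{if } v\notin i(V^s_N),\end{cases}$$ is $A$-reciprocal and satisfies the condition that for every $v\in V^r_N\setminus\{0\}$ either $\rho(v)=0$ or $\rho(v)\in R^\times$. Moreover, letting $W=\{0\}\cup\{v\in V^r_N\setminus\{0\}\mid\rho(v)\in R^\times\}$, letting $\lambda\colon W\to R$ be the map with $\lambda(0)=0$ and $\lambda(v)=\rho(v)^{-1}$ for $v\ne0$, and letting $\varphi\colon A\to R[\tau]$ be the $\mathbb{F}_q$-algebra homomorphism associated to $\rho$, we have $(W,\lambda\circ i,\varphi)=(i(V^s_N),\lambda',\varphi')$.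
   Context: $\mathbb{F}_q$ is a finite field with $q$ elements. $A$ is an admissible coefficient ring containing $\mathbb{F}_q$, i.e. the ring of elements of a global function field $F\supset\mathbb{F}_q$ that are regular outside one fixed place $\infty$; so $F=\mathrm{Quot}(A)$. For $a\in A\setminus\{0\}$ put $\deg_A(a)=\dim_{\mathbb{F}_q}(A/(a))$, and $\deg_A(0)=-\infty$. For a non-zero ideal $N\subset A$ put $\mathrm{Div}(N)=\{a\in A\mid N\subset (a)\}$. The image of $a\in A$ in an $F$-algebra is again denoted $a$. Level assumption on a non-zero proper ideal $N\subset A$: there exists a subset $D\subset\mathrm{Div}(N)$ such that (i) for any $a\in A\setminus\{0\}$ there is $b\in A\setminus\{0\}$ which is a product of elements of $D$ with $\deg_A(a-b)<\deg_A(a)$; (ii) for any distinct $a,b\in D$ we have $ab\in\mathrm{Div}(N)$; (iii) any element of $\mathrm{Div}(N)$ is a product of elements of $D$; (iv) $N$ is principal. For any integer $r\ge1$, $V^r_N=(N^{-1}/A)^{\oplus r}$, where $N^{-1}\subset F$ is the inverse fractional ideal of $N$, and $V^r_a=(a^{-1}A/A)^{\oplus r}$ for $a\in A\setminus\{0\}$; for $a\in\mathrm{Div}(N)$ we have $V^r_a\subset V^r_N$. A map $\rho\colon V^r_N\setminus\{0\}\to R$ is $A$-reciprocal if (1) $\rho(v)\rho(w)=\rho(v+w)(\rho(v)+\rho(w))$ for all $v,w\in V^r_N\setminus\{0\}$ with $v+w\ne0$, and (2) $a\rho(av)=\sum_{v'\in V^r_a}\rho(v-v')$ for all $a\in\mathrm{Div}(N)$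 and $v\in V^r_N\setminus V^r_a$. $R[\tau]$ is the ring (under composition) of $\mathbb{F}_q$-linear polynomials $\sum_i u_iX^{q^i}=\sum_iu_i\tau^i$ over $R$. The homomorphism associated to an $A$-reciprocal map $\rho$ is the unique $\mathbb{F}_q$-algebra homomorphism $\varphi\colon A\to R[\tau]$, $a\mapsto\varphi_a$, such that $\varphi_a(X)=a\cdot X\cdot\prod_{v\in V^r_a\setminus\{0\}}(1-\rho(v)X)$ for all $a\in\mathrm{Div}(N)$ (it exists and is unique). A standard Drinfeld $A$-module of rank $s\ge1$ over $R$ is an $\mathbb{F}_q$-algebra homomorphism $\varphi'\colon A\to R[\tau]$ such that for every $a\in A\setminus\{0\}$ we have $\varphi'_a=\sum_{i=0}^{s\deg_A(a)}\varphi'_{a,i}\tau^i$ with $\varphi'_{a,s\deg_A(a)}\in R^\times$ and $\varphi'_{a,0}=a$. Put $\varphi'[N]=\bigcap_{a\in N}\mathrm{Ker}(\varphi'_a)\subset\mathbb{G}_{a,R}$. A level $N$-structure of $\varphi'$ is an $A$-module homomorphism $V^s_N\to\varphi'[N](R)\subset R$ ($A$ acting on $R$ through $\varphi'$) which induces an isomorphism in every (geometric) fiber over $\mathrm{Spec}(R)$. *)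

(* Defs.v *)
From HB Require Import structures.
From mathcomp Require Import all_boot all_order all_algebra.
From mathcomp Require Import mathcomp_extra boolp classical_sets functions.
From mathcomp Require Import cardinality fsbigop constructive_ereal.
Set Implicit Arguments.
Unset Strict Implicit.
Unset Printing Implicit Defensive.
Import Order.TTheory GRing.Theory Num.Theory.
Local Open Scope ring_scope.
Local Open Scope classical_set_scope.

(* A finite field Fq, an Fq-algebra A and a field F containing A through an
   injective ring morphism j : A -> F.  The Fq-structure of F is c |-> j c%:A. *)

Section FunctionField.
Variables (Fq : finFieldType) (F : fieldType) (k : {rmorphism Fq -> F}).

Definition transcendental (t : F) : Prop :=
  forall p : {poly Fq}, p != 0 -> (map_poly k p).[t] != 0.

Definition rational_in (t : F) : set F :=
  [set x | exists p g : {poly Fq},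
     (map_poly k g).[t] != 0 /\ x = (map_poly k p).[t] / (map_poly k g).[t]].

Definition global_function_field : Prop :=
  exists2 t : F, transcendental t &
    exists (n : nat) (e : 'I_n -> F), forall x : F, exists c : 'I_n -> F,
      (forall i, rational_in t (c i)) /\ x = \sum_i c i * e i.

(* Places are identified with their valuation rings Fq < O < F. *)
Definition place (O : set F) : Prop :=
  [/\ forall c : Fq, O (k c),
      forall x y, O x -> O y -> O (x - y) /\ O (x * y),
      forall x, O x \/ O x^-1 &
      exists x, ~ O x].

End FunctionField.

Definition admissible (Fq : finFieldType) (A : comAlgType Fq) (F : fieldType)
    (j : {rmorphism A -> F}) (infty : set F) : Prop :=
  let k : {rmorphism Fq -> F} := j \o in_alg A in
  [/\ injective j,
      global_function_field k,
      place k infty &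
      forall x : F, (exists a : A, x = j a) <->
        (forall O : set F, place k O -> O <> infty -> O x)].

Section Degree.
Variables (Fq : finFieldType) (A : comAlgType Fq).

(* dim_Fq (A / (a)) = d: some d-tuple of elements of A reduces to an Fq-basis
   of A / (a). *)
Definition quotient_dim (a : A) (d : nat) : Prop :=
  exists e : 'I_d -> A, forall x : A, exists! c : {ffun 'I_d -> Fq},
    exists y : A, x = \sum_i c i *: e i + a * y.

(* The dimension is finite for a != 0 in an admissible coefficient ring; the
   default value is irrelevant. *)
Definition degA (a : A) : nat := xget 0%N [set d | quotient_dim a d].

Definition edegA (a : A) : \bar int :=
  if a == 0 then -oo%E else (Posz (degA a))%:E.

End Degree.

Section Level.
Variables (Fq : finFieldType) (A : comAlgType Fq) (N : idealr A).

Definition DivN : set A :=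
  [set a | forall x, x \in N -> exists y, x = a * y].

Definition product_of (D : set A) (b : A) : Prop :=
  exists s : seq A, (forall x, x \in s -> D x) /\ b = \prod_(x <- s) x.

Definition level_assumption : Prop :=
  exists2 D : set A, D `<=` DivN &
    [/\ forall a, a != 0 -> exists b,
          [/\ b != 0, product_of D b & (edegA (a - b) < edegA a)%E],
        forall a b, D a -> D b -> a != b -> DivN (a * b),
        forall a, DivN a -> product_of D a &
        exists n : A, forall x, x \in N <-> exists y, x = n * y].

End Level.

Section Torsion.
Variables (A : comNzRingType) (F : fieldType) (j : {rmorphism A -> F}).

Definition imA : {pred F} := fun x => `[< exists a, x = j a >].

Lemma imA_zmod_closed : zmod_closed imA.
Proof.
split=> [|x y /asboolP[a ->] /asboolP[b ->]]; apply/asboolP.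
  by exists 0; rewrite rmorph0.
by exists (a - b); rewrite rmorphB.
Qed.

HB.instance Definition _ := GRing.isZmodClosed.Build F imA imA_zmod_closed.

Definition FmodA : Type := Quotient.quot imA.
HB.instance Definition _ := GRing.Zmodule.on FmodA.

Definition to_FmodA (x : F) : FmodA := \pi_(Quotient.quot imA)%qT x.

Definition scale_FmodA (a : A) (x : FmodA) : FmodA :=
  to_FmodA (j a * repr (x : Quotient.quot imA)).

Lemma to_FmodAD x y : to_FmodA (x + y) = to_FmodA x + to_FmodA y.
Proof. exact: (raddfD (\pi_(Quotient.quot imA)%qT)). Qed.

Lemma scale_to_FmodA a x : scale_FmodA a (to_FmodA x) = to_FmodA (j a * x).
Proof.
rewrite /scale_FmodA /to_FmodA; apply/eqP.
rewrite -Quotient.idealrBE -mulrBr.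
have : (repr (\pi_(Quotient.quot imA)%qT x) - x) \in imA.
  by rewrite Quotient.idealrBE reprK.
move=> /asboolP[b ->]; apply/asboolP; exists (a * b); by rewrite rmorphM.
Qed.

Lemma to_FmodA_surj (u : FmodA) : exists x, u = to_FmodA x.
Proof. by exists (repr (u : Quotient.quot imA)); rewrite /to_FmodA reprK. Qed.

Lemma scale_FmodAA a b v :
  scale_FmodA a (scale_FmodA b v) = scale_FmodA (a * b) v.
Proof.
have [x ->] := to_FmodA_surj v.
by rewrite !scale_to_FmodA rmorphM mulrA.
Qed.

Lemma scale_FmodA1 : left_id 1 scale_FmodA.
Proof.
move=> v; have [x ->] := to_FmodA_surj v.
by rewrite !scale_to_FmodA rmorph1 mul1r.
Qed.

Lemma scale_FmodADr : right_distributive scale_FmodA +%R.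
Proof.
move=> a u v; have [x ->] := to_FmodA_surj u; have [y ->] := to_FmodA_surj v.
by rewrite -to_FmodAD !scale_to_FmodA -to_FmodAD mulrDr.
Qed.

Lemma scale_FmodADl v : {morph scale_FmodA^~ v : a b / a + b}.
Proof.
move=> a b; have [x ->] := to_FmodA_surj v.
by rewrite !scale_to_FmodA -to_FmodAD rmorphD mulrDl.
Qed.

HB.instance Definition _ := GRing.Zmodule_isLmodule.Build A FmodA
  scale_FmodAA scale_FmodA1 scale_FmodADr scale_FmodADl.

Variable N : idealr A.

Definition inverse_ideal : set F :=
  [set x | forall n, n \in N -> exists a, x * j n = j a].

Definition NinvA : {pred FmodA} :=
  fun u => `[< exists2 x, inverse_ideal x & u = to_FmodA x >].

Lemma NinvA_submod_closed : submod_closed NinvA.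
Proof.
split.
  apply/asboolP; exists 0; last by rewrite /to_FmodA raddf0.
  by move=> n _; exists 0; rewrite mul0r rmorph0.
move=> a u v /asboolP[x xN ->] /asboolP[y yN ->]; apply/asboolP.
exists (j a * x + y); last by rewrite to_FmodAD -scale_to_FmodA.
move=> n nN; have [b xb] := xN n nN; have [c yc] := yN n nN.
by exists (a * b + c); rewrite mulrDl -mulrA xb yc rmorphD rmorphM.
Qed.

HB.instance Definition _ :=
  GRing.isSubmodClosed.Build A FmodA NinvA NinvA_submod_closed.

Record torsN : Type := TorsN { torsN_val :> FmodA; _ : torsN_val \in NinvA }.
HB.instance Definition _ := [isSub for torsN_val].
HB.instance Definition _ := [Choice of torsN by <:].
HB.instance Definition _ := [SubChoice_isSubLmodule of torsN by <:].

(* V^r_N = (N^-1 / A)^r, where N^-1 / A is a submodule of F / A *)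
Definition VN (r : nat) : Type := {ffun 'I_r -> torsN}.
HB.instance Definition _ (r : nat) := GRing.Lmodule.copy (VN r) {ffun 'I_r -> torsN}.

(* V^r_a = (a^-1 A / A)^r, viewed inside V^r_N; meaningful for a in Div(N) *)
Definition Va (r : nat) (a : A) : set (VN r) :=
  [set v | forall i, exists b : A, torsN_val (v i) = to_FmodA (j b / j a)].

End Torsion.

Section Modules.
Variables (Fq : finFieldType) (A : comAlgType Fq) (F : fieldType).
Variables (j : {rmorphism A -> F}) (N : idealr A) (R : comUnitAlgType F).

Definition imR (a : A) : R := (j a)%:A.

(* Only the values of rho on V^r_N \ {0} matter. *)
Definition reciprocal (r : nat) (rho : VN j N r -> R) : Prop :=
  (forall v w : VN j N r, v != 0 -> w != 0 -> v + w != 0 ->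
     rho v * rho w = rho (v + w) * (rho v + rho w)) /\
  (forall (a : A) (v : VN j N r), DivN N a -> ~ Va a v ->
     imR a * rho (a *: v) = \sum_(v' \in @Va A F j N r a) rho (v - v')).

(* R[tau]: the polynomials sum_i u_i X^(q^i), a ring under composition *)
Definition Fq_linear (p : {poly R}) : Prop :=
  exists (n : nat) (u : 'I_n -> R), p = \sum_i u i *: 'X^(#|Fq| ^ i).

Definition algebra_hom (phi : A -> {poly R}) : Prop :=
  [/\ forall a, Fq_linear (phi a),
      forall a b, phi (a + b) = phi a + phi b,
      forall a b, phi (a * b) = phi a \Po phi b,
      phi 1 = 'X &
      forall (c : Fq) a, phi (c *: a) = imR c%:A *: phi a].

Definition associated_hom (r : nat) (rho : VN j N r -> R)
    (phi : A -> {poly R}) : Prop :=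
  algebra_hom phi /\
  forall a, DivN N a ->
    phi a = imR a *: 'X *
      \big[*%R/1]_(v \in @Va A F j N r a `\ 0) (1 - rho v *: 'X).

Definition standard_Drinfeld_module (s : nat) (phi : A -> {poly R}) : Prop :=
  algebra_hom phi /\
  forall a, a != 0 -> exists u : nat -> R,
    [/\ phi a = \sum_(i < (s * degA a).+1) u i *: 'X^(#|Fq| ^ i),
        u (s * degA a)%N \is a GRing.unit &
        u 0%N = imR a].

(* phi[N] pulled back along a point f : R -> K of Spec R is the closed
   subscheme of the affine line over K cut out by this ideal. *)
Definition torsion_ideal (phi : A -> {poly R}) (K : fieldType)
    (f : {rmorphism R -> K}) : set {poly K} :=
  [set p | exists (n : nat) (a : 'I_n -> A) (g : 'I_n -> {poly K}),
     (forall i, a i \in N) /\ p = \sum_i g i * map_poly f (phi (a i))].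

(* The morphism from the constant K-scheme V^s_N to phi[N]_K is an isomorphism
   iff it is one on coordinate rings, i.e. iff the evaluation map from
   K[X] / torsion_ideal to the K-valued functions on V^s_N is bijective. *)
Definition fiber_isomorphism (s : nat) (phi : A -> {poly R})
    (lam : VN j N s -> R) (K : fieldType) (f : {rmorphism R -> K}) : Prop :=
  (forall p : {poly K}, (forall v, p.[f (lam v)] = 0) ->
     torsion_ideal phi f p) /\
  (forall h : VN j N s -> K, exists p : {poly K},
     forall v, p.[f (lam v)] = h v).

Definition level_structure (s : nat) (phi : A -> {poly R})
    (lam : VN j N s -> R) : Prop :=
  [/\ forall v w, lam (v + w) = lam v + lam w,
      forall a v, lam (a *: v) = (phi a).[lam v],
      forall v a, a \in N -> (phi a).[lam v] = 0 &
      forall (K : fieldType) (f : {rmorphism R -> K}),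
        fiber_isomorphism phi lam f].

(* The w with v = i w is unique when i is injective; x^-1 is the inverse of x
   only when x is a unit. *)
Definition rho_of (r s : nat) (i : VN j N s -> VN j N r) (lam : VN j N s -> R)
    (v : VN j N r) : R :=
  if `[< exists w, v = i w >] then (lam (xget 0 [set w | v = i w]))^-1 else 0.

Definition support_of (r : nat) (rho : VN j N r -> R) : set (VN j N r) :=
  [set v | v = 0 \/ (v != 0 /\ rho v \is a GRing.unit)].

Definition lambda_of (r : nat) (rho : VN j N r -> R) (v : VN j N r) : R :=
  if v == 0 then 0 else (rho v)^-1.

End Modules.

(* Main.v *)
(* Over a field-valued point of R, the level structure identifies V^s_N with
   the roots of phi'_n, where N = (n): this makes V^s_N finite, makes lambda'
   unit-valued off 0 (otherwise reduce modulo a maximal ideal), and forces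
   deg phi'_n = #V^s_N.  If n = ab, then deg phi'_n = deg phi'_a deg phi'_b, so
   the lambda'(w) for w in V^s_a already exhaust the roots of phi'_a and
     phi'_a = c prod_(w in V^s_a) (X - lambda'(w)).
   Comparing the coefficients of X gives the product formula defining the
   homomorphism associated to rho.  Since phi'_a has constant derivative a, its
   logarithmic derivative at lambda'(w) is condition (2) at i(w); translating
   by V^r_a settles v in i(V^s_N) + V^r_a, and for the other v both sides are
   0.  By (i) of the level assumption Div(N) generates A, whence uniqueness. *)
From HB Require Import structures.
Require Import Defs.
From mathcomp Require Import all_boot all_order all_algebra.
From mathcomp Require Import boolp classical_sets.
From mathcomp Require Import cardinality fsbigop constructive_ereal ring zify.
Set Implicit Arguments.
Unset Strict Implicit.
Unset Printing Implicit Defensive.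
Import GRing.Theory.
Local Open Scope ring_scope.
Local Open Scope classical_set_scope.

(** * Maximal ideals and residue fields *)

(** Zorn's lemma for the proper ideals containing [x]. Maximality is recorded as invertibility
    modulo [M] of every element outside [M], the form that makes the quotient a field. *)
Lemma maximal_ideal_exists (R : comUnitRingType) (x : R) :
  x \isn't a GRing.unit ->
  exists M : set R,
    [/\ M x, ~ M 1, forall a u v, M u -> M v -> M (a * u + v) &
      forall y, ~ M y -> exists c, M (1 - c * y)].
Proof.
move=> xNunit.
pose ideal (M : set R) :=
  [/\ M x, ~ M 1 & forall a u v, M u -> M v -> M (a * u + v)].
have ideal0 M : ideal M -> M 0.
  by case=> Mx _ MD; rewrite -(addNr x) -mulN1r; apply: MD.
have [F FP Ftot|M [PM Mmax]] := @Zorn_bigcup R (fun M => M = set0 \/ ideal M).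
  have [[z [M0 FM0 M0z]]|none] := pselect ((\bigcup_(M in F) M) !=set0);
    last first.
    by left; apply: contrapT => /eqP/set0P.
  have FI M u : F M -> M u -> ideal M.
    by move=> FM Mu; case: (FP _ FM) => // M_0; rewrite M_0 in Mu.
  right; split.
  - by exists M0 => //; case: (FI _ _ FM0 M0z).
  - by case=> M FM M1; case: (FI _ _ FM M1).
  move=> a u v [M FM Mu] [M' FM' M'v].
  have [MM'|M'M] := Ftot M M' FM FM'.
    by exists M' => //; case: (FI _ _ FM' M'v) => _ _; apply => //; apply: MM'.
  by exists M => //; case: (FI _ _ FM Mu) => _ _; apply => //; apply: M'M.
have [Mx M1 MD] : ideal M.
  case: PM => // M0; exfalso.
  apply: (Mmax [set y | exists c, y = c * x]).
    rewrite M0; split=> // /(_ 0); apply.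
    by exists 0; rewrite mul0r.
  right; split.
  - by exists 1; rewrite mul1r.
  - case=> c c1; move/negP: xNunit; apply; apply/unitrPr.
    by exists c; rewrite mulrC.
  - by move=> a _ _ [c ->] [d ->]; exists (a * c + d); rewrite mulrDl mulrA.
exists M; split=> // y NMy.
have M0 : M 0 by apply: ideal0.
(* The ideal [M + (y)]; by maximality it must contain 1. *)
pose M' : set R := [set z | exists c, M (z - c * y)].
have MM' : M `<` M'.
  split=> [u Mu|sub]; first by exists 0; rewrite mul0r subr0.
  by apply: NMy; apply: sub; exists 1; rewrite mul1r subrr.
apply: contrapT => H; apply: (Mmax M' MM'); right; split.
- by exists 0; rewrite mul0r subr0.
- by case=> c Mc; apply: H; exists c.
move=> a u v [c Mc] [d Md]; exists (a * c + d).
rewrite mulrDl opprD addrACA -mulrA -mulrBr; exact: MD.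
Qed.

Lemma residue_field (R : comUnitRingType) (x : R) :
  x \isn't a GRing.unit ->
  exists (K : fieldType) (f : {rmorphism R -> K}), f x = 0.
Proof.
move=> /maximal_ideal_exists[M [Mx M1 MD Mmax]].
pose I : pred R := fun u => `[< M u >].
have M0 : M 0 by rewrite -(addNr x) -mulN1r; apply: MD.
have I_ideal : idealr_closed I.
  split.
  - exact/asboolP.
  - by apply/negP => /asboolP.
  - by move=> a u v /asboolP Mu /asboolP Mv; apply/asboolP; apply: MD.
pose I_mixin := isIdealr.Build R I I_ideal.
pose J : idealr R := HB.pack I I_mixin.
pose Q : comNzRingType := {ideal_quot J}.
pose pr : R -> Q := \pi_{ideal_quot J}%qT.
(* The second clause enforces the convention that the inverse of 0 is 0, demanded by the field
   structure. *)
have Qinv (q : Q) : exists p : Q, (q != 0 -> p * q = 1) /\ (q = 0 -> p = 0).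
  have [->|q0] := eqVneq q 0.
    by exists 0; split.
  have : ~ M (repr q).
    move=> Mq; case/negP: q0; rewrite -[q]reprK piE.
    by rewrite Quotient.equivE subr0; apply/asboolP.
  move=> /Mmax[c Mc]; exists (pr c).
  split=> [_|/eqP]; last by rewrite (negPf q0).
  rewrite -[q]reprK -rmorphM -[1](rmorph1 pr) /=; apply/eqP.
  rewrite eq_sym -Quotient.idealrBE.
  exact/asboolP.
have [inv inv_spec] := choice Qinv.
pose Kmix := GRing.ComNzRing_isField.Build Q (fun q => (inv_spec q).1)
  ((inv_spec 0).2 erefl).
pose K : fieldType := HB.pack (Quotient.quot J) Kmix.
exists K, pr.
rewrite -[RHS](rmorph0 pr); apply/eqP; rewrite -Quotient.idealrBE subr0.
exact/asboolP.
Qed.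

(** Degrees of polynomials over [R], which may have zero divisors, are compared at such a point. *)
Lemma residue_field_nonempty (R : comUnitRingType) :
  exists K : fieldType, inhabited {rmorphism R -> K}.
Proof.
have [K [f _]] : exists (K : fieldType) (f : {rmorphism R -> K}), f 0 = 0.
  by apply: residue_field; rewrite unitr0.
by exists K.
Qed.

(** * Torsion in V^r_N *)

Section Torsion.
Variables (A : comNzRingType) (F : fieldType) (j : {rmorphism A -> F}).
Hypothesis j_inj : injective j.
Variable N : idealr A.

Lemma to_FmodA_eq0 (x : F) : to_FmodA j x = 0 <-> exists a, x = j a.
Proof.
have -> : (to_FmodA j x = 0) <-> (x \in imA j).
  rewrite -[x in x \in _]subr0 Quotient.idealrBE /to_FmodA.
  have <- : \pi_(Quotient.quot (imA j))%qT 0 = 0 :> FmodA j by rewrite raddf0.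
  by split=> [->//|/eqP].
by split=> /asboolP.
Qed.

Lemma torsN_valZ (a : A) (u : torsN j N) :
  torsN_val (a *: u) = scale_FmodA a (torsN_val u).
Proof. exact: GRing.valZ. Qed.

Lemma torsN_val_eq0 (u : torsN j N) : torsN_val u = 0 <-> u = 0.
Proof.
split=> [u0|->]; last exact: (raddf0 (val : torsN j N -> FmodA j)).
by apply: val_inj; rewrite raddf0.
Qed.

Lemma VN_ann (r : nat) (m : A) (v : VN j N r) : m \in N -> m *: v = 0.
Proof.
move=> mN; apply/ffunP => k; rewrite !ffunE; apply/torsN_val_eq0.
have /asboolP[x xN vx] := valP (v k).
rewrite torsN_valZ [torsN_val (v k)]vx scale_to_FmodA; apply/to_FmodA_eq0.
by have [b xb] := xN m mN; exists b; rewrite mulrC.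
Qed.

(** In each coordinate, [j a * x] lies in A iff [x] lies in a^-1 A; so V^r_a is the kernel of [a],
    which is how it is handled below. *)
Lemma VaP (r : nat) (a : A) (v : VN j N r) :
  a != 0 -> Va a v <-> a *: v = 0.
Proof.
move=> a0; have ja0 : j a != 0 by move: a0; rewrite -(inj_eq j_inj) rmorph0.
split=> [vVa|av0 k].
  apply/ffunP => k; rewrite !ffunE; apply/torsN_val_eq0.
  have [b vb] := vVa k.
  rewrite torsN_valZ vb scale_to_FmodA; apply/to_FmodA_eq0.
  by exists b; rewrite mulrC divfK.
have : torsN_val (a *: v k) = 0.
  by apply/torsN_val_eq0; move/ffunP: av0 => /(_ k); rewrite !ffunE.
rewrite torsN_valZ; have [x ->] := to_FmodA_surj (torsN_val (v k)).
rewrite scale_to_FmodA => /to_FmodA_eq0[b jab]; exists b.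
by rewrite -jab mulrC mulKf.
Qed.

(** A coordinate killed by [b] has the form c/b = a (c/n), and c/n lies in N^-1 because N = (n). *)
Lemma Va_divisible (s : nat) (n a b : A) (w : VN j N s) :
  n != 0 -> (forall x, x \in N <-> exists y, x = n * y) -> n = a * b ->
  b *: w = 0 -> exists u : VN j N s, w = a *: u.
Proof.
move=> n0 Nn nab bw0.
have /andP[a0 b0] : (a != 0) && (b != 0).
  apply/andP; split; apply: contra n0 => /eqP; rewrite nab => ->.
    by rewrite mul0r.
  by rewrite mulr0.
have j0 x : x != 0 -> j x != 0 by rewrite -(inj_eq j_inj) rmorph0.
have coord k : exists u : torsN j N, w k = a *: u.
  have [c wc] := (VaP w b0).2 bw0 k.
  have uN : to_FmodA j (j c / j n) \in @NinvA _ _ j N.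
    apply/asboolP; exists (j c / j n) => // m /Nn[y ->].
    by exists (c * y); rewrite !rmorphM mulrA divfK ?j0.
  exists (TorsN uN); apply: val_inj; rewrite linearZ /= wc /GRing.scale /=.
  rewrite scale_to_FmodA nab rmorphM; congr to_FmodA.
  by field; rewrite !j0.
have [u wu] := choice coord.
by exists [ffun k => u k]; apply/ffunP => k; rewrite !ffunE.
Qed.

End Torsion.

(** * Finite fields and split polynomials *)

(** Translation by 1 permutes [K], so the sum S of all elements satisfies S = S + #K. *)
Lemma natr_card_finField (K : finFieldType) : #|K|%:R = 0 :> K.
Proof.
apply: (@addrI _ (\sum_(x : K) x)).
rewrite addr0 [RHS](reindex_inj (addIr 1)) /=.
by rewrite big_split sumr_const.
Qed.

(** In the presence of zero divisors, splitting off linear factors one after another calls for roots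
    whose differences are units. *)
Lemma uniq_roots_map (T : eqType) (R : comUnitRingType) (f : T -> R)
    (E : seq T) :
  (forall v w, v != w -> f v - f w \is a GRing.unit) ->
  uniq E -> uniq_roots (map f E).
Proof.
move=> f_sep; elim: E => //= v E IH /andP[vE /IH ->]; rewrite andbT.
apply/allP => _ /mapP[w wE ->].
rewrite /diff_roots mulrC eqxx f_sep //.
by apply: contraNneq vE => <-.
Qed.

(** The logarithmic derivative of a split polynomial, with the denominator cleared. *)
Lemma deriv_prod_XsubC (T : eqType) (R : comUnitRingType) (f : T -> R)
    (E : seq T) (x : R) :
  (forall v, v \in E -> x - f v \is a GRing.unit) ->
  (\prod_(v <- E) ('X - (f v)%:P))^`().[x] =
  (\prod_(v <- E) ('X - (f v)%:P)).[x] * \sum_(v <- E) (x - f v)^-1.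
Proof.
elim: E => [|v E IH] xf; first by rewrite !big_nil -polyC1 derivC horner0 mulr0.
rewrite !big_cons derivM derivXsubC mul1r hornerD !hornerM hornerXsubC.
rewrite IH => [|u uE]; last by rewrite xf // inE uE orbT.
by rewrite mulrDr mulrAC divrr ?xf ?mem_head // mul1r mulrA.
Qed.

(** * Drinfeld modules with a level structure: derivatives, degrees, units and finiteness *)

Section LevelStructure.
Variables (Fq : finFieldType) (A : comAlgType Fq) (F : fieldType).
Variables (j : {rmorphism A -> F}) (N : idealr A) (R : comUnitAlgType F).
Variables (s : nat) (phi : A -> {poly R}) (lam : VN j N s -> R).
Hypothesis phi_std : standard_Drinfeld_module j s phi.
Hypothesis lam_level : level_structure phi lam.

Let phi_hom : algebra_hom j phi := phi_std.1.

Lemma natr_card_base : #|Fq|%:R = 0 :> R.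
Proof.
have := congr1 (fun c : Fq => (j c%:A)%:A : R) (natr_card_finField Fq).
by rewrite scaler_nat !rmorph_nat scaler_nat scale0r rmorph0 scale0r.
Qed.

Lemma Drinfeld_comp a b : phi (a * b) = phi a \Po phi b.
Proof. by case: phi_hom. Qed.

Lemma Drinfeld0 a : (phi a).[0] = 0.
Proof.
case: phi_hom => /(_ a)[d [u ->]] _ _ _ _.
rewrite horner_sum big1 // => i _.
rewrite hornerZ hornerXn expr0n expn_eq0 -leqn0.
by rewrite leqNgt (ltnW (card_finNzRing_gt1 _)) mulr0.
Qed.

(** For i > 0 the derivative of X^(q^i) has the factor q = 0, so only the linear term
    contributes. *)
Lemma Drinfeld_deriv a : a != 0 -> (phi a)^`() = (imR j R a)%:P.
Proof.
move=> /phi_std.2[u [-> _ <-]].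
rewrite raddf_sum big_ord_recl big1 ?addr0 => [|i _].
  by rewrite /= derivZ expn0 expr1 derivX alg_polyC.
rewrite /= derivZ derivXn expnS.
by rewrite -scaler_nat natrM natr_card_base mul0r scale0r scaler0.
Qed.

Lemma Drinfeld_lead a : a != 0 -> lead_coef (phi a) \is a GRing.unit.
Proof.
move=> /phi_std.2[u [-> u_unit _]].
have sz : size (u (s * degA a)%N *: 'X^(#|Fq| ^ (s * degA a)) : {poly R}) =
    (#|Fq| ^ (s * degA a)).+1.
  by rewrite (lreg_size _ (mulrI u_unit)) size_polyXn.
rewrite big_ord_recr /= lead_coefDr.
  by rewrite (lead_coef_lreg _ (mulrI u_unit)) lead_coefXn mulr1.
rewrite sz ltnS (leq_trans (size_sum _ _ _)) //; apply/bigmax_leqP => i _.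
rewrite (leq_trans (size_scale_leq _ _)) // size_polyXn.
by rewrite ltn_exp2l ?card_finNzRing_gt1.
Qed.

(** The leading coefficient is a unit and stays nonzero in [K], so degrees can be read off in any
    fiber. *)
Lemma size_map_Drinfeld (K : fieldType) (f : {rmorphism R -> K}) a :
  a != 0 -> size (map_poly f (phi a)) = size (phi a).
Proof.
move=> /Drinfeld_lead u; apply: size_map_poly_id0.
by rewrite -unitfE rmorph_unit.
Qed.

Lemma size_Drinfeld_gt0 a : a != 0 -> (0 < size (phi a))%N.
Proof.
move=> /Drinfeld_lead; rewrite size_poly_gt0.
by apply: contraTneq => ->; rewrite lead_coef0 unitr0.
Qed.

Lemma levelD v w : lam (v + w) = lam v + lam w.
Proof. by case: lam_level. Qed.

Lemma level0 : lam 0 = 0.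
Proof. by apply: (@addrI _ (lam 0)); rewrite -levelD !addr0. Qed.

Lemma levelB v w : lam (v - w) = lam v - lam w.
Proof. by apply: (@addIr _ (lam w)); rewrite -levelD !subrK. Qed.

Lemma levelZ a v : lam (a *: v) = (phi a).[lam v].
Proof. by case: lam_level. Qed.

(** By the surjective half of the fiber isomorphism, some polynomial interpolates the indicator
    function of [v]. *)
Lemma level_separates (K : fieldType) (f : {rmorphism R -> K}) v w :
  f (lam v) = f (lam w) -> v = w.
Proof.
case: lam_level => _ _ _ /(_ K f)[_ /(_ (fun u => (u == v)%:R))[p pE]] fvw.
have := pE v; rewrite fvw pE eqxx; case: eqP => //= _ /eqP.
by rewrite eq_sym oner_eq0.
Qed.

(** A nonunit vanishes at some field-valued point, where [lam w] and [lam 0] would then coincide. *)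
Lemma level_unit w : w != 0 -> lam w \is a GRing.unit.
Proof.
apply: contraR => /residue_field[K [f fw0]]; apply/eqP.
by apply: (@level_separates _ f); rewrite fw0 level0 rmorph0.
Qed.

Lemma level_sub_unit v w : v != w -> lam v - lam w \is a GRing.unit.
Proof. by rewrite -levelB -subr_eq0; apply: level_unit. Qed.

(** In a fiber the values of [lam] are distinct roots of the nonzero polynomial given by [phi n],
    since [n] kills V^s_N. *)
Lemma level_finite n :
  n \in N -> n != 0 -> exists E : seq (VN j N s), uniq E /\ forall v, v \in E.
Proof.
move=> nN n0; have [K [f]] := residue_field_nonempty R.
have [/finite_seqP[E EP]|inf] := pselect (finite_set [set: VN j N s]).
  exists (undup E); split=> [|v]; first exact: undup_uniq.
  by rewrite mem_undup; have : [set: VN j N s] v by []; rewrite EP.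
have [B _ sB] := infinite_set_fset (size (phi n)) inf.
suff : (size (map (f \o lam) (finmap.enum_fset B)) <
    size (map_poly f (phi n)))%N.
  by rewrite size_map size_map_Drinfeld // ltnNge sB.
apply: max_poly_roots.
- by rewrite -size_poly_gt0 size_map_Drinfeld // size_Drinfeld_gt0.
- apply/allP => _ /mapP[v _ ->]; rewrite /root horner_map -levelZ VN_ann //.
  by rewrite level0 rmorph0.
- by rewrite map_inj_uniq ?finmap.fset_uniq // => v w /= /level_separates.
Qed.

(** * Splitting of [phi a] for [a] in Div(N) *)

Variable n : A.
Hypothesis n_neq0 : n != 0.
Hypothesis Nn : forall x, x \in N <-> exists y, x = n * y.

Let n_in : n \in N.
Proof. by apply/Nn; exists 1; rewrite mulr1. Qed.

Variable E : seq (VN j N s).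
Hypothesis E_uniq : uniq E.
Hypothesis E_all : forall v, v \in E.

(** For nonzero [a] and injective [j], an enumeration of V^s_a. *)
Definition ann_seq (a : A) : seq (VN j N s) := [seq v <- E | a *: v == 0].

Lemma mem_ann_seq a v : (v \in ann_seq a) = (a *: v == 0).
Proof. by rewrite mem_filter E_all andbT. Qed.

(** The product of the X - f(lam v) vanishes at every point, so by the injective half of the fiber
    isomorphism it lies in the torsion ideal, all of whose members are multiples of the image of
    [phi n]. *)
Lemma size_Drinfeld_generator : (size (phi n) <= (size E).+1)%N.
Proof.
have [K [f]] := residue_field_nonempty R.
pose p := \prod_(z <- map (f \o lam) E) ('X - z%:P).
have p0 : p != 0 by rewrite monic_neq0 ?monic_prod_XsubC.
have [m [a [g [aN pE]]]] : torsion_ideal N phi f p.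
  case: lam_level => _ _ _ /(_ K f)[+ _]; apply=> v; apply/eqP.
  by rewrite -/(root _ _) root_prod_XsubC (map_f (f \o lam)).
rewrite -(size_map_Drinfeld f n_neq0) -(size_map (f \o lam) E).
rewrite -(size_prod_XsubC _ id).
apply: dvdp_leq => //; rewrite -/p pE.
apply: (big_ind (fun q => map_poly f (phi n) %| q)) => [|q q'|k _].
- exact: dvdp0.
- exact: dvdp_add.
have [y ->] := (Nn _).1 (aN k).
(* [phi (y * n)] is the composite of [phi y] with [phi n]; as X divides [phi y], [phi n] divides the
   composite. *)
rewrite dvdp_mull // mulrC Drinfeld_comp map_comp_poly.
have /factor_theorem[h ->] : root (phi y) 0 by apply/eqP/Drinfeld0.
by rewrite subr0 rmorphM /= map_polyX comp_polyM comp_polyX dvdp_mull.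
Qed.

(** If [r] chooses preimages under multiplication by [a] (arbitrary off its image), then v |-> (v -
    r(av), av) injects V^s_N into the product of the two torsion sets. *)
Lemma size_ann_seqM a b :
  n = a * b -> (size E <= size (ann_seq a) * size (ann_seq b))%N.
Proof.
move=> nab.
have /choice[r rP] (y : VN j N s) :
    exists u, (exists v, y = a *: v) -> y = a *: u.
  by have [[v ->]|H] := pselect (exists v, y = a *: v); [exists v|exists 0].
have rK v : a *: r (a *: v) = a *: v by rewrite -rP //; exists v.
pose g v := (v - r (a *: v), a *: v).
rewrite -(size_allpairs pair) -(size_map g E); apply: uniq_leq_size.
  by rewrite map_inj_uniq // => v w [+ avw]; rewrite avw => /addIr.
move=> _ /mapP[v _ ->]; apply/allpairsP; exists (g v); split=> //=.
  by rewrite mem_ann_seq scalerBr rK subrr.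
by rewrite mem_ann_seq scalerA mulrC -nab VN_ann.
Qed.

(** The values of [lam] on the [a]-torsion are roots of [phi a] with pairwise unit differences. *)
Lemma Drinfeld_ann_dvd a :
  exists q, phi a = q * \prod_(w <- ann_seq a) ('X - (lam w)%:P).
Proof.
rewrite -(big_map lam xpredT (fun z => 'X - z%:P)).
apply: uniq_roots_prod_XsubC.
  apply/allP => _ /mapP[w + ->]; rewrite mem_ann_seq => /eqP aw.
  by rewrite /root -levelZ aw level0.
by apply: uniq_roots_map; [apply: level_sub_unit|apply: filter_uniq].
Qed.

(* deg phi_a >= #V_a always; as deg phi_n = #V_N <= #V_a #V_b for n = ab,
   equality must hold for a and b. *)
Lemma Drinfeld_split a : DivN N a ->
  exists c, phi a = c *: \prod_(w <- ann_seq a) ('X - (lam w)%:P).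
Proof.
move=> /(_ n n_in)[b nab].
have /andP[a0 b0] : (a != 0) && (b != 0).
  apply/andP; split; apply: contra n_neq0 => /eqP; rewrite nab => ->.
    by rewrite mul0r.
  by rewrite mulr0.
have size_ge x : x != 0 -> (size (ann_seq x) <= (size (phi x)).-1)%N.
  move=> x0; have [q qE] := Drinfeld_ann_dvd x.
  have : phi x != 0 by rewrite -size_poly_gt0 size_Drinfeld_gt0.
  rewrite qE; have [->|q0 _] := eqVneq q 0; first by rewrite mul0r eqxx.
  rewrite size_Mmonic ?monic_prod_XsubC //.
  rewrite size_prod_XsubC.
  by rewrite (polySpred q0) addSn /= addnS /= leq_addl.
(* Degrees multiply under composition over a field, hence the passage to a fiber. *)
have size_mul : (size (phi n)).-1 = ((size (phi a)).-1 * (size (phi b)).-1)%N.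
  have [K [f]] := residue_field_nonempty R.
  rewrite -!(size_map_Drinfeld f) // nab Drinfeld_comp map_comp_poly.
  exact: size_comp_poly.
have E_gt0 x : (0 < size (ann_seq x))%N.
  by rewrite -has_predT; apply/hasP; exists 0; rewrite // mem_ann_seq scaler0.
have size_a : size (phi a) = (size (ann_seq a)).+1.
  have le_ab : ((size (phi a)).-1 * (size (phi b)).-1 <=
      size (ann_seq a) * size (ann_seq b))%N.
    rewrite -size_mul (leq_trans _ (size_ann_seqM nab)) //.
    by rewrite -ltnS prednK ?size_Drinfeld_gt0 ?size_Drinfeld_generator.
  (* Each degree is at least the matching torsion count, and the product of the degrees is at most
     the product of the counts; positive counts then force equality. *)
  have := size_Drinfeld_gt0 a0; have := E_gt0 a; have := E_gt0 b.
  have := size_ge a a0; have := size_ge b b0.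
  by nia.
have [q qE] := Drinfeld_ann_dvd a.
have q0 : q != 0.
  apply: contra_eq_neq size_a => q0; by rewrite qE q0 mul0r size_poly0.
move: size_a; rewrite {1}qE size_Mmonic ?monic_prod_XsubC //.
rewrite size_prod_XsubC.
rewrite addnS /= -add1n => /eqP; rewrite eqn_add2r => /size_poly1P[c _ qc].
by exists c; rewrite qE qc mul_polyC.
Qed.

(** Evaluate the logarithmic derivative of the split form at [lam w]: the derivative is the constant
    [a], and the value [lam (a *: w)] is a unit. *)
Lemma Drinfeld_log_deriv a w : DivN N a -> a *: w != 0 ->
  imR j R a * (lam (a *: w))^-1 = \sum_(u <- ann_seq a) (lam (w - u))^-1.
Proof.
move=> aN aw; have [c phiE] := Drinfeld_split aN.
have a0 : a != 0 by apply: contraNneq aw => ->; rewrite scale0r.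
have unit_u u : u \in ann_seq a -> lam w - lam u \is a GRing.unit.
  rewrite mem_ann_seq => au; apply: level_sub_unit.
  by apply: contraNneq aw => ->.
have phi_unit : (phi a).[lam w] \is a GRing.unit by rewrite -levelZ level_unit.
have -> : imR j R a = (phi a)^`().[lam w] by rewrite Drinfeld_deriv // hornerC.
rewrite levelZ {1}phiE derivZ hornerZ deriv_prod_XsubC // mulrA -hornerZ -phiE.
rewrite mulrC mulKr //.
by apply: eq_bigr => u _; rewrite levelB.
Qed.

Lemma Drinfeld_prod a : DivN N a ->
  phi a = imR j R a *: 'X *
    \prod_(w <- ann_seq a | w != 0) (1 - (lam w)^-1 *: 'X).
Proof.
move=> aN; have [c phiE] := Drinfeld_split aN.
have a0 : a != 0.
  apply: contra_neq n_neq0 => a0.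
  by have [b ->] := aN n n_in; rewrite a0 mul0r.
pose Q := \prod_(w <- ann_seq a | w != 0) (1 - (lam w)^-1 *: 'X).
have [d phiQ] : exists d, phi a = d *: ('X * Q).
  (* The root 0 gives the factor X; from every other factor X - lam w the unit -lam w is pulled
     out. *)
  exists (c * \prod_(w <- ann_seq a | w != 0) - lam w).
  rewrite phiE (bigD1_seq 0) ?mem_ann_seq ?scaler0 ?filter_uniq //=.
  rewrite level0 subr0 -scalerA; congr (_ *: _).
  rewrite scalerAr; congr (_ * _); rewrite -scaler_prod.
  apply: eq_bigr => w w0.
  by rewrite scalerBr scalerA mulNr divrr ?level_unit // scaleN1r opprK
    scaleNr alg_polyC addrC.
have -> : imR j R a = d.
  (* [Q] takes the value 1 at 0, so the derivative at 0 isolates [d]. *)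
  have : (phi a)^`().[0] = d.
    rewrite phiQ derivZ derivM derivX mul1r hornerZ hornerD hornerM hornerX.
    rewrite mul0r addr0 /Q horner_prod big1 ?mulr1 // => w _.
    by rewrite hornerD hornerN hornerZ hornerX mulr0 subr0 hornerC.
  by rewrite Drinfeld_deriv // hornerC.
by rewrite phiQ -scalerAl.
Qed.

End LevelStructure.

(** * Uniqueness of the associated homomorphism, then the theorem *)

(** Induction on the degree: by (i), [a] differs from a product of elements of [D] by an element of
    lower degree, and multiplicativity settles the product. *)
Lemma algebra_hom_ext (Fq : finFieldType) (A : comAlgType Fq) (F : fieldType)
    (j : {rmorphism A -> F}) (N : idealr A) (R : comUnitAlgType F)
    (phi psi : A -> {poly R}) :
  level_assumption N -> algebra_hom j phi -> algebra_hom j psi ->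
  (forall a, DivN N a -> phi a = psi a) -> forall a, phi a = psi a.
Proof.
case=> D DN [D_approx _ _ _] [_ phiD phiM phi1 _] [_ psiD psiM psi1 _] eqDiv.
have eq0 : phi 0 = psi 0.
  have add0 (f : A -> {poly R}) :
      (forall a b, f (a + b) = f a + f b) -> f 0 = 0.
    by move=> fD; apply: (@addrI _ (f 0)); rewrite -fD !addr0.
  by rewrite !add0.
have eqD b : product_of D b -> phi b = psi b.
  case=> t [tD ->]; elim: t tD => [|x t IH] tD.
    by rewrite big_nil phi1 psi1.
  rewrite big_cons phiM psiM IH => [|y yt].
    by rewrite eqDiv //; apply/DN/tD/mem_head.
  by apply: tD; rewrite inE yt orbT.
move=> a; have [m] := ubnP (degA a); elim: m a => // m IH a am.
have [->//|a0] := eqVneq a 0.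
have [b [b0 /eqD eqb ab]] := D_approx a a0.
rewrite -(subrK b a) phiD psiD eqb; congr (_ + _).
(* A zero difference has degree -oo, outside the induction on natural numbers. *)
have [->//|ab0] := eqVneq (a - b) 0.
apply: IH; move: ab; rewrite /edegA (negPf ab0) (negPf a0).
by rewrite lte_fin ltz_nat => ab; apply: leq_trans ab _.
Qed.

Theorem proposition2p5p5
    (Fq : finFieldType) (A : comAlgType Fq) (F : fieldType)
    (j : {rmorphism A -> F}) (infty : set F)
    (HA : admissible j infty)
    (N : idealr A) (N_neq0 : exists2 n, n \in N & n != 0)
    (HN : level_assumption N)
    (R : comUnitAlgType F)
    (r s : nat) (r_ge1 : (1 <= r)%N) (s_ge1 : (1 <= s)%N) (s_le_r : (s <= r)%N)
    (phi' : A -> {poly R}) (Hphi' : standard_Drinfeld_module j s phi')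
    (lambda' : VN j N s -> R) (Hlambda' : level_structure phi' lambda')
    (i : {linear VN j N s -> VN j N r}) (i_inj : injective i) :
  let rho : VN j N r -> R := rho_of i lambda' in
  [/\ (forall w : VN j N s, w != 0 -> lambda' w \is a GRing.unit),
      reciprocal rho,
      (forall v : VN j N r, v != 0 -> rho v = 0 \/ rho v \is a GRing.unit) &
      [/\ support_of rho = range i,
          (forall w : VN j N s, lambda_of rho (i w) = lambda' w),
          associated_hom rho phi' &
          (forall phi : A -> {poly R}, associated_hom rho phi ->
             forall a : A, phi a = phi' a)]].
Proof.
move=> rho.
have [j_inj _ _ _] := HA.
have [n Nn] : exists n, forall x, x \in N <-> exists y, x = n * y.
  by case: HN => D _ [_ _ _].
have n0 : n != 0.
  have [m mN] := N_neq0; apply: contraNneq => n0; apply/eqP.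
  by have [y ->] := (Nn m).1 mN; rewrite n0 mul0r.
have nN : n \in N by apply/Nn; exists 1; rewrite mulr1.
have DivP a : DivN N a -> a != 0 /\ exists b, n = a * b.
  move=> /(_ n nN)[b nab]; split; last by exists b.
  by apply: contraNneq n0 => a0; rewrite nab a0 mul0r.
have [E [E_uniq E_all]] := level_finite Hphi' Hlambda' nN n0.
have lam_unit w : w != 0 -> lambda' w \is a GRing.unit.
  exact: level_unit Hlambda' w.
have lam0 := level0 Hlambda'.
have i0 w : (i w == 0) = (w == 0) by rewrite -(inj_eq i_inj) raddf0.
have rho_i w : rho (i w) = (lambda' w)^-1.
  rewrite /rho /rho_of asboolT; last by exists w.
  by rewrite (@xget_unique _ 0 _ w) // => u /i_inj.
have rho_out v : ~ range i v -> rho v = 0.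
  by move=> iv; rewrite /rho /rho_of asboolF // => -[w vw]; apply: iv; exists w.
have range_iB v w : range i v -> range i w -> range i (v - w).
  by move=> [x _ <-] [y _ <-]; exists (x - y); rewrite ?raddfB.
have range_iK v w : range i w -> range i (v + w) -> range i v.
  by move=> iw ivw; rewrite -(addrK w v); apply: range_iB.
have annE a w : a *: w = 0 <-> a *: i w = 0.
  split=> aw0; first by rewrite -linearZ aw0 raddf0.
  by apply/eqP; rewrite -i0 linearZ /= aw0.
split=> //.
- split=> [v w v0 w0 vw0|a v aN va].
    (* Condition (1): if [v] or [w] is outside the image of [i], both sides vanish, for when just
       one of them is outside, so is the sum. *)
    have [[x _ xv]|iv] := pselect (range i v); last first.
      rewrite (rho_out v) // mul0r add0r.
      have [iw|/rho_out->] := pselect (range i w); last by rewrite mulr0.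
      by rewrite (rho_out (v + w)) ?mul0r // => /(range_iK _ _ iw).
    have [[y _ yw]|iw] := pselect (range i w); last first.
      rewrite (rho_out w) // mulr0 (rho_out (v + w)) ?mul0r // addrC.
      by apply: contra_not iw; apply: range_iK; exists x.
    move: v0 w0 vw0; rewrite -xv -yw -raddfD !i0 !rho_i (levelD Hlambda').
    move=> /lam_unit ux /lam_unit uy /lam_unit.
    rewrite (levelD Hlambda') => uxy.
    apply: (mulrI uxy); rewrite mulVKr // mulrDl mulrA divrr // mul1r mulrCA.
    by rewrite divrr // mulr1 addrC.
  have [a0 [b nab]] := DivP a aN.
  (* Condition (2), according to whether [v] lies in i(V^s_N) + V^r_a. *)
  have [[x avx]|nox] := pselect (exists x, a *: (v - i x) = 0); last first.
    rewrite rho_out ?mulr0 => [|[w _ wav]].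
      rewrite fsbig1 // => v' /(VaP j_inj _ a0) av'.
      apply: rho_out => -[x _ xE]; apply: nox; exists x.
      by rewrite xE opprB addrC subrK.
    (* If av = i(w), then bw = 0 since n kills [v]; so w = au by divisibility, and v - i(u) lies in
       V^r_a. *)
    apply: nox; have [|u wu] := Va_divisible j_inj n0 Nn nab (w := w).
      apply/annE; rewrite wav scalerA mulrC -nab.
      exact: VN_ann.
    by exists u; rewrite scalerBr -wav wu linearZ subrr.
  have av : a *: v = i (a *: x).
    by apply/eqP; rewrite linearZ -subr_eq0 -scalerBr avx.
  rewrite av rho_i.
  rewrite (Drinfeld_log_deriv Hphi' Hlambda' n0 Nn E_uniq E_all aN); last first.
    by rewrite -i0 -av; apply/eqP => /(VaP j_inj _ a0).
  rewrite fsbig_seq ?filter_uniq //.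
  (* Only those v' with v - v' in the image of [i] contribute; they are parametrized by u |-> v -
     i(x) + i(u), with [u] in V^s_a and v - v' = i(x - u). *)
  rewrite -(fsbig_widen (Va a `&` [set v' | range i (v - v')])) =>
    [|v' []//|v' []]; last first.
    by move=> v'a nv'; apply: rho_out => iv'; apply: nv'; split.
  rewrite (reindex_fsbig (fun u => v - i x + i u) [set` ann_seq E a]).
    apply: eq_fsbigr => u _.
    by rewrite opprD addrA opprB addrCA subrr addr0 -raddfB rho_i.
  split=> [u|u u' _ _|v' [v'a [y _ yE]]].
  + rewrite /= mem_ann_seq // => /eqP au; split.
      by apply/(VaP j_inj _ a0); rewrite scalerDr avx -linearZ au raddf0 addr0.
    exists (x - u) => //.
    by rewrite opprD addrA opprB addrCA subrr addr0 raddfB.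
  + by move=> /addrI/i_inj.
  exists (x - y).
    rewrite /= mem_ann_seq //; apply/eqP/annE.
    rewrite linearB /= yE opprB addrCA scalerDr ((VaP j_inj _ a0).1 v'a) add0r.
    by rewrite -[i x - v]opprB scalerN avx oppr0.
  by rewrite linearB /= yE opprB addrA subrK addrCA subrr addr0.
- move=> v v0; have [[w _ wv]|/rho_out->] := pselect (range i v); last by left.
  by right; rewrite -wv rho_i unitrV lam_unit // -i0 wv.
have assoc : associated_hom rho phi'.
  split=> [|a aN]; first exact: Hphi'.1.
  have [a0 _] := DivP a aN.
  rewrite (Drinfeld_prod Hphi' Hlambda' n0 Nn E_uniq E_all aN); congr (_ * _).
  rewrite -big_filter fsbig_seq ?filter_uniq //.
  (* Outside the image of [i] the map [rho] is 0 and the factor is 1. *)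
  rewrite -(fsbig_widen ((Va a `\ 0) `&` range i)) => [|v []//|v []];
    last first.
    move=> va nv; rewrite /= rho_out ?scale0r ?subr0 // => iv.
    by apply: nv; split.
  rewrite (reindex_fsbig i [set` [seq w <- ann_seq E a | w != 0]]).
    by apply: eq_fsbigr => w _; rewrite rho_i.
  split=> [w|w w' _ _ /i_inj//|v [[/(VaP j_inj _ a0) aw w0] [w _ wE]]].
  - rewrite /= mem_filter mem_ann_seq // => /andP[w0 /eqP/annE aw].
    split; last by exists w.
    by split; [apply/(VaP j_inj _ a0)|apply/eqP; rewrite i0].
  exists w; rewrite // /= mem_filter mem_ann_seq // -i0 wE.
  by apply/andP; split; apply/eqP => //; apply/annE; rewrite wE.
split=> //.
- apply/seteqP; split=> [v [->|[v0]]|_ [w _ <-]].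
  + by exists 0; rewrite ?raddf0.
  + by apply: contraPP => /rho_out->; rewrite unitr0.
  have [->|w0] := eqVneq w 0; first by left; rewrite raddf0.
  by right; rewrite i0 rho_i unitrV lam_unit.
- move=> w; rewrite /lambda_of i0; case: eqP => [->//|_].
  by rewrite rho_i invrK.
move=> phi phi_assoc; apply: (algebra_hom_ext HN phi_assoc.1 Hphi'.1) => a aN.
by rewrite phi_assoc.2 // assoc.2.
Qed.
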